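(* Let $m,r\ge 1$ be integers, let $A\in\mathbb{R}^{m\times m}$ and $B,C\in\mathbb{R}^{m\times r}$, and let $\chi(\lambda,\mu)=\det\big(A-\lambda BC^T-\mu I_m\big)$, a polynomial in the two variables $\lambda,\mu$. If $\operatorname{tr}(BC^T)\neq 0$, then $\chi(\lambda,\mu)$ admits a term of the form $\lambda\mu^{m-1}$, i.e. the coefficient of the monomial $\lambda\mu^{m-1}$ in $\chi$ is nonzero.
   Context: $I_m$ is the $m\times m$ identity matrix and $\operatorname{tr}$ denotes the trace. *)

(* Defs.v *)
(* MathComp world. The field of real numbers is an arbitrary [R : realType]. *)
From mathcomp Require Import all_boot all_order all_algebra.
From mathcomp Require Import reals.

Set Implicit Arguments.
Unset Strict Implicit.
Unset Printing Implicit Defensive.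

Import GRing.Theory.
Local Open Scope ring_scope.

(* Bivariate polynomials are elements of {poly {poly R}}: the inner variable
   'X%:P is lambda and the outer variable 'X is mu, so that the coefficient of
   lambda ^ i * mu ^ j in p is p`_j`_i. *)
Definition chi (R : realType) (m r : nat) (A : 'M[R]_m) (B C : 'M[R]_(m, r)) :
    {poly {poly R}} :=
  \det (map_mx (fun a : R => a%:P%:P) A
        - ('X%:P : {poly {poly R}}) *:
            map_mx (fun a : R => a%:P%:P) (B *m C^T)
        - ('X : {poly {poly R}})%:M).

(* chi is the polynomial whose value at every real point (lambda, mu) is the
   numerical determinant. *)
Lemma chi_eval (R : realType) (m r : nat) (A : 'M[R]_m) (B C : 'M[R]_(m, r))
    (lambda mu : R) :
  (chi A B C).[mu%:P].[lambda] = \det (A - lambda *: (B *m C^T) - mu%:M).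
Proof.
rewrite /chi -[LHS]/(horner_eval lambda (horner_eval mu%:P _)).
rewrite -!det_map_mx; congr (\det _); apply/matrixP => i j.
by rewrite !mxE /= /horner_eval !(hornerE, hornerMn).
Qed.

(* Main.v *)
(* With N = A - lambda B C^T over R[lambda], chi is (-1)^m times the
   characteristic polynomial of N, so its coefficient of mu^(m-1) is
   (-1)^(m-1) tr N, which is affine in lambda with slope (-1)^m tr (B C^T). *)
Require Import Defs.
From mathcomp Require Import all_boot all_order all_algebra.
From mathcomp Require Import reals.

Set Implicit Arguments.
Unset Strict Implicit.
Unset Printing Implicit Defensive.

Import GRing.Theory.
Local Open Scope ring_scope.

(** Negating the whole matrix, here ['X%:M - N] with [N] mapped to constants in mu, scales an m by m
    determinant by [(-1) ^+ m]. *)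
Lemma chi_char_poly (R : realType) (m r : nat) (A : 'M[R]_m)
    (B C : 'M[R]_(m, r)) :
  chi A B C =
  (-1) ^+ m *
  char_poly (map_mx polyC A - 'X *: map_mx polyC (B *m C^T)).
Proof.
rewrite /chi /char_poly -detZ; congr (\det _); apply/matrixP => i j.
by rewrite !mxE polyCB polyCM mulN1r opprB.
Qed.

Theorem lemma2 (R : realType) (m r : nat) (hm : (1 <= m)%N) (hr : (1 <= r)%N)
    (A : 'M[R]_m) (B C : 'M[R]_(m, r)) (htr : \tr (B *m C^T) != 0) :
  (chi A B C)`_(m - 1)`_1 != 0.
Proof.
(* Only the parity of m matters: the sign becomes a conditional negation, harmless for being
   nonzero. *)
rewrite chi_char_poly subn1 -signr_odd mulr_sign; set N := map_mx _ _ - _.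
have trN1 : (\tr N)`_1 = - \tr (B *m C^T).
  rewrite /N raddfB /= mxtraceZ !trace_map_mx.
  by rewrite coefB coefXM coefC sub0r coefC.
have cN1 : (char_poly N)`_m.-1`_1 = \tr (B *m C^T).
  (* The subleading coefficient is [- \tr N], which needs [hm]; its sign cancels the one in
     [trN1]. *)
  by rewrite char_poly_trace // coefN trN1 opprK.
by case: (odd m); rewrite ?coefN ?cN1 ?oppr_eq0.
Qed.
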